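(* Assume the standing hypotheses on the continuous problem and on the space discretization listed in the context. Assume also that $\partial u\neq0$ (the boundary data $g$ does not vanish), that $c_1<c_2<\dots<c_s$, that $c_i\ne1$ for $i=1,\dots,s$, and that there exist $C'$, $h_0$ such that $$\|\tau A_{h,0}e^{\tau A_{h,0}}\|_h\le C',\qquad \tau\ge0,\ h\le h_0.$$ Then the local error of the classical Lawson full discretization satisfies $$\rho_{h,n}=O(1),\qquad A_{h,0}^{-1}\rho_{h,n}=O(k),$$ where the constant in the Landau notation is independent of $k$ and $h$.
   Context: **Continuous problem.** $\Omega\subset\mathbb R^d$ is a bounded domain, $X=C(\overline\Omega)$ with the maximum norm, $Y$ is a Banach space, $A:D(A)\subset X\to X$ and $\partial:D(A)\to Y$ are linear. $u$ is the solution of $u'(t)=Au(t)+f(t,u(t))$, $0\le t\le T$, $u(0)=u_0\in X$, $\partial u(t)=g(t)\in Y$, with $f:[0,T]\times X\to X$ (in general nonlinear) and $g:[0,T]\to Y$. *Standing hypotheses on the continuous problem:* (i) $\partial:D(A)\to Y$ is onto and $g\in C^1([0,T],Y)$. (ii) $\ker\partial$ is dense in $X$ and $A_0$, the restriction of $A$ to $D(A_0)=\ker\partial$, generates a $C_0$-semigroup $\{e^{tA_0}\}_{t\ge0}$ on $X$ of negative type $\omega$. (iii) For $\Re z>0$ and $v\in Y$ the problem $Ax=zx$, $\partial x=v$ has a unique solution $x=K(z)v$, and $\|K(z)v\|\le C\|v\|$ with $C$ uniform for $\Re z\ge\omega_0>\omega$. (iv) $f\in C^1([0,T]\times X,X)$.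 (v) $u\in C^1([0,T],X)$, $u(t)\in D(A)$ for all $t\in[0,T]$, $Au\in C([0,T],X)$. **Space discretization.** For a mesh parameter $h$, $\Omega_h$ is a grid with $N$ nodes; $\|\cdot\|_h$ is the maximum norm on $\mathbb C^N$ (and the induced operator norms); $P_h:X\to\mathbb C^N$ maps a function to its values on the grid; $A_{h,0}$ is an $N\times N$ matrix (discretizing $A_0$) and $C_h:Y\to\mathbb C^N$ is linear, so that $A$ acting on functions with $\partial u=g$ is discretized by $A_{h,0}U_h+C_hg$. The function $f$ also makes sense as a map $[0,T]\times\mathbb C^N\to\mathbb C^N$ and $P_hf(t,u)=f(t,P_hu)$ for $t\in[0,T]$, $u\in X$. *Standing hypotheses on the discretization:* (a) $\|e^{tA_{h,0}}\|_h\le1$ for $t\ge0$; $A_{h,0}$ is invertible and $\|A_{h,0}^{-1}\|_h\le C$ with $C$ independent of $h$. (b) Let $R_h:D(A)\to\mathbb C^N$ be defined by $A_{h,0}R_hu+C_h\partial u=P_hAu$. There is a subspace $Z\subset D(A)$ with norm $\|\cdot\|_Z$ such that for $u\in Z$: $A_0^{-1}u\in Z$ and $e^{tA_0}u,f(t,u)\in Z$ for $t\in[0,T]$; $\|A_{h,0}(P_hu-R_hu)\|_h\le\varepsilon_h\|u\|_Z$ and $\|P_hu-R_hu\|_h\le\eta_h\|u\|_Z$, with $\varepsilon_h,\eta_h$ small with $h$. Moreover $\|A_{h,0}^{-1}C_h\|_h\le C''$ with $C''$ independent of $h$. (c) $f\in C^1([0,T]\times\mathbb C^N,\mathbb C^N)$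 and its derivative with respect to the variable in $\mathbb C^N$ is uniformly bounded in a neighbourhood of the solution where the numerical approximation stays. **Classical Lawson discretization (first space, then time).** Let $a_{ij}$ ($j<i$), $b_i$, $c_i$ ($1\le i\le s$) be the coefficients of an explicit Runge–Kutta tableau. Let $k>0$ be the time stepsize, $t_n=nk$, with $t_{n+1}\le T$. The scheme is applied with one step starting from $P_hu(t_n)$: for $i=1,\dots,s$, $$\bar K_{h,i}^n=e^{c_ikA_{h,0}}P_hu(t_n)+k\sum_{j=1}^{i-1}a_{ij}e^{(c_i-c_j)kA_{h,0}}[C_hg(t_n+c_jk)+f(t_n+c_jk,\bar K^n_{h,j})],$$ $$\bar U_h^{n+1}=e^{kA_{h,0}}P_hu(t_n)+k\sum_{i=1}^sb_ie^{(1-c_i)kA_{h,0}}[C_hg(t_n+c_ik)+f(t_n+c_ik,\bar K_{h,i}^n)].$$ The local error is $\rho_{h,n+1}=\bar U_h^{n+1}-P_hu(t_{n+1})$. All $O(\cdot)$ bounds are in $\|\cdot\|_h$. *)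

(* Defs.v *)
From HB Require Import structures.
From mathcomp Require Import all_boot all_order all_algebra.
From mathcomp Require Import all_classical all_reals all_analysis.
From mathcomp.real_closed Require Import complex.

Set Implicit Arguments.
Unset Strict Implicit.
Unset Printing Implicit Defensive.

Import Order.TTheory GRing.Theory Num.Theory numFieldNormedType.Exports.

Local Open Scope classical_set_scope.
Local Open Scope complex_scope.
Local Open Scope ring_scope.

HB.instance Definition _ (R : rcfType) := NormedModule.copy R[i] R[i]^o.

(* Over R[i] the library norm `|v| is R[i]-valued; rnorm is the same norm with
   values in R (see rnormE). *)
Definition rnorm (R : rcfType) (V : normedZmodType R[i]) (v : V) : R :=
  complex.Re `|v|.

Section rnorm_theory.
Variables (R : rcfType) (V : normedZmodType R[i]).
Implicit Types v w : V.

Lemma rnormE v : `|v| = (rnorm v)%:C.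
Proof. by rewrite /rnorm RRe_real // normr_real. Qed.

Lemma rnorm_ge0 v : 0 <= rnorm v.
Proof. by rewrite -ler0c -rnormE normr_ge0. Qed.

Lemma rnormD v w : rnorm (v + w) <= rnorm v + rnorm w.
Proof. by rewrite -lecR rmorphD /= -!rnormE ler_normD. Qed.

Lemma rnorm0_eq0 v : rnorm v = 0 -> v = 0.
Proof. by move=> v0; apply/normr0_eq0; rewrite rnormE v0. Qed.

End rnorm_theory.

Lemma rnormM (R : rcfType) (a b : R[i]) : rnorm (a * b) = rnorm a * rnorm b.
Proof. by apply: (@complexI R); rewrite rmorphM /= -!rnormE normrM. Qed.

Lemma rnorm_continuous (R : realType) (V : normedModType R[i]) :
  continuous (@rnorm R V).
Proof.
move=> v; apply/cvgrPdist_lt => e e0.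
have e0C : 0 < e%:C by rewrite -[0]/(0%:C) ltcR.
near=> w.
have : `|v - w| < e%:C by near: w; exact: (@cvgr_dist_lt _ _ _ (nbhs v) _ id).
rewrite -ltcR; apply: le_lt_trans; rewrite rnormE lecR ler_norml.
apply/andP; split.
  rewrite lerNl opprB lerBlDr -[X in rnorm X <= _](subrK v).
  by rewrite (le_trans (rnormD _ _))// /rnorm distrC.
by rewrite lerBlDr -[X in rnorm X <= _](subrK w) (le_trans (rnormD _ _)).
Unshelve. all: by end_near. Qed.

Record bounded_domain (R : realType) (d : nat) := BoundedDomain {
  domain_set :> set 'rV[R]_d ;
  domain_open : open domain_set ;
  domain_connected : connected domain_set ;
  domain_nonempty : domain_set !=set0 ;
  domain_bounded : bounded_set domain_set
}.

(* The complex-valued continuous functions on the closure of the domain; the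
   norm is the maximum norm Cbar_norm below (a sup over a nonempty compact set). *)
Definition Cbar (R : realType) (d : nat) (O : bounded_domain R d) : Type :=
  continuousType (closure (O : set 'rV[R]_d)) R[i].

Section Cbar_normed.
Variables (R : realType) (d : nat) (O : bounded_domain R d).
Local Notation K := (closure (O : set 'rV[R]_d)).
Local Notation X := (Cbar O).

Definition Cbar_fun (u : X) : K -> R[i] := u.

Lemma Cbar_ext (u v : X) : Cbar_fun u =1 Cbar_fun v -> u = v.
Proof. by move/continuousEP. Qed.

Lemma Cbar_continuous (u : X) : continuous (Cbar_fun u).
Proof. exact: (@cts_fun _ _ u). Qed.

Definition Cbar_mk (f : K -> R[i]) (cf : continuous f) : X :=
  mkcts cf : continuousType _ _.

Lemma Cbar_mkE f cf : Cbar_fun (@Cbar_mk f cf) = f.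
Proof. by []. Qed.

HB.instance Definition _ := gen_eqMixin X.
HB.instance Definition _ := gen_choiceMixin X.

Lemma Cbar0_subproof : continuous (fun _ : K => 0 : R[i]).
Proof. by move=> x; exact: (@cst_continuous K R[i]). Qed.

Lemma CbarN_subproof (u : X) : continuous (fun x : K => - Cbar_fun u x).
Proof.
move=> x; have cu := @Cbar_continuous u x.
by apply: (@cvgN _ R[i] _ (nbhs x) _ (Cbar_fun u) _ cu).
Qed.

Lemma CbarD_subproof (u v : X) :
  continuous (fun x : K => Cbar_fun u x + Cbar_fun v x).
Proof.
move=> x; have cu := @Cbar_continuous u x; have cv := @Cbar_continuous v x.
by apply: (@cvgD _ R[i] _ (nbhs x) _ (Cbar_fun u) (Cbar_fun v) _ _ cu cv).
Qed.

Lemma CbarZ_subproof (a : R[i]) (u : X) :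
  continuous (fun x : K => a * Cbar_fun u x).
Proof.
move=> x; have cu := @Cbar_continuous u x.
by apply: (@cvgZl_tmp _ R[i] _ (nbhs x) _ a (Cbar_fun u) _ cu).
Qed.

Definition Cbar0 : X := Cbar_mk Cbar0_subproof.
Definition CbarN u : X := Cbar_mk (@CbarN_subproof u).
Definition CbarD u v : X := Cbar_mk (@CbarD_subproof u v).
Definition CbarZ a u : X := Cbar_mk (@CbarZ_subproof a u).

Lemma CbarA : associative CbarD.
Proof. by move=> u v w; apply: Cbar_ext => x /=; exact: addrA. Qed.
Lemma CbarC : commutative CbarD.
Proof. by move=> u v; apply: Cbar_ext => x /=; exact: addrC. Qed.
Lemma Cbar_add0 : left_id Cbar0 CbarD.
Proof. by move=> u; apply: Cbar_ext => x /=; exact: add0r. Qed.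
Lemma Cbar_addN : left_inverse Cbar0 CbarN CbarD.
Proof. by move=> u; apply: Cbar_ext => x /=; exact: addNr. Qed.

HB.instance Definition _ :=
  GRing.isZmodule.Build X CbarA CbarC Cbar_add0 Cbar_addN.

Lemma CbarZA a b u : CbarZ a (CbarZ b u) = CbarZ (a * b) u.
Proof. by apply: Cbar_ext => x /=; exact: mulrA. Qed.
Lemma CbarZ1 : left_id 1 CbarZ.
Proof. by move=> u; apply: Cbar_ext => x /=; exact: mul1r. Qed.
Lemma CbarZDr : right_distributive CbarZ +%R.
Proof. by move=> a u v; apply: Cbar_ext => x /=; exact: mulrDr. Qed.
Lemma CbarZDl u : {morph CbarZ^~ u : a b / a + b}.
Proof. by move=> a b; apply: Cbar_ext => x /=; exact: mulrDl. Qed.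

HB.instance Definition _ :=
  GRing.Zmodule_isLmodule.Build R[i] X CbarZA CbarZ1 CbarZDr CbarZDl.

Lemma compact_closure_domain : compact K.
Proof.
apply: bounded_closed_compact; last exact: closed_closure.
have [M [Mr OM]] := @domain_bounded _ _ O; exists M; split => // r Mltr x.
have cB : closed [set y : 'rV[R]_d | `|y| <= r].
  apply: (@preimage_closed _ _ (fun y : 'rV[R]_d => `|y| : R) [set t | t <= r]).
    by move=> y _; exact: norm_continuous.
  exact: closed_le.
have /closure_subset OB : (O : set _) `<=` [set y : 'rV[R]_d | `|y| <= r].
  by move=> y Oy; exact: OM Mltr y Oy.
by move/OB/cB.
Qed.

Lemma Cbar_rnorm_continuous (u : X) :
  continuous (fun x : K => rnorm (Cbar_fun u x)).
Proof.
move=> x; apply: continuous_comp; first exact: Cbar_continuous.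
exact: (@rnorm_continuous R R[i]).
Qed.

Definition Cbar_norm (u : X) : R := sup (range (fun x : K => rnorm (Cbar_fun u x))).

Lemma Cbar_has_ubound (u : X) :
  has_ubound (range (fun x : K => rnorm (Cbar_fun u x))).
Proof.
have /subspace_valL_continuousP cu := @Cbar_rnorm_continuous u.
have /compact_bounded[M [Mr uM]] :=
  continuous_compact cu compact_closure_domain.
exists (M + 1) => _ [x _ <-]; rewrite (le_trans (ler_norm _))//.
apply: (uM (M + 1)); first by rewrite ltrDl.
exists (val x); first exact: set_mem (valP x).
exact: (congr1 (fun g : K -> R => g x) (valLK point (fun x : K => rnorm (Cbar_fun u x)))).
Qed.

Lemma Cbar_norm_ge (u : X) (x : K) : rnorm (Cbar_fun u x) <= Cbar_norm u.
Proof. by apply: ub_le_sup; [exact: Cbar_has_ubound|exists x]. Qed.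

Lemma Cbar_norm_le (u : X) (M : R) :
  (forall x, rnorm (Cbar_fun u x) <= M) -> Cbar_norm u <= M.
Proof.
move=> uM; apply: ge_sup => [|_ [x _ <-]]; last exact: uM.
have [y Oy] := @domain_nonempty _ _ O.
by have Ky := mem_set (subset_closure Oy); exists (rnorm (Cbar_fun u (exist _ y Ky))); exists (exist _ y Ky).
Qed.

Lemma Cbar_normD u v :
  (Cbar_norm (u + v))%:C <= (Cbar_norm u)%:C + (Cbar_norm v)%:C.
Proof.
rewrite -rmorphD lecR; apply: Cbar_norm_le => x.
by rewrite (le_trans (rnormD _ _))// lerD// Cbar_norm_ge.
Qed.

Lemma Cbar_normZ a u : (Cbar_norm (a *: u))%:C = `|a| * (Cbar_norm u)%:C.
Proof.
rewrite rnormE -rmorphM; congr (_%:C).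
have leZ b w : Cbar_norm (b *: w) <= rnorm b * Cbar_norm w.
  apply: Cbar_norm_le => x.
  by rewrite [leLHS]rnormM ler_wpM2l ?rnorm_ge0 ?Cbar_norm_ge.
apply/eqP; rewrite eq_le leZ /=.
have [->|a0] := eqVneq a 0.
  rewrite /rnorm normr0 mul0r; have [y Oy] := @domain_nonempty _ _ O.
  have Ky := mem_set (subset_closure Oy).
  by rewrite (le_trans _ (Cbar_norm_ge _ (exist _ y Ky)))// rnorm_ge0.
have ra : 0 < rnorm a.
  by rewrite lt_neqAle rnorm_ge0 andbT eq_sym; apply: contra_neq a0 => /rnorm0_eq0.
have rV : rnorm a * rnorm a^-1 = 1.
  by rewrite -rnormM divff// /rnorm normr1.
have := leZ a^-1 (a *: u); rewrite scalerA mulVf// scale1r => H.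
by rewrite (le_trans (ler_wpM2l (ltW ra) H))// mulrA rV mul1r.
Qed.

Lemma Cbar_norm0_eq0 u : (Cbar_norm u)%:C = 0 -> u = 0.
Proof.
move=> u0; apply: Cbar_ext => x; apply: rnorm0_eq0; apply/eqP.
rewrite eq_le rnorm_ge0 andbT (le_trans (Cbar_norm_ge _ _))//.
by move/(@complexI R): u0 => ->.
Qed.

HB.instance Definition _ := @Lmodule_isNormed.Build R[i] X
  (fun u => (Cbar_norm u)%:C) Cbar_normD Cbar_normZ Cbar_norm0_eq0.

End Cbar_normed.

Section linear_notions.
Variables (R : realType) (V W : normedModType R[i]).

Definition opnorm (f : V -> W) : \bar R :=
  ereal_sup [set (rnorm (f v))%:E | v in [set v : V | rnorm v <= 1]].

Definition linear_subspace (D : set V) : Prop :=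
  D 0 /\ forall (a : R[i]) v w, D v -> D w -> D (a *: v + w).

Definition linear_on (D : set V) (f : V -> W) : Prop :=
  forall (a : R[i]) v w, D v -> D w -> f (a *: v + w) = a *: f v + f w.

Definition real_linear (f : V -> W) : Prop :=
  (forall v w, f (v + w) = f v + f w) /\
  (forall (a : R) v, f (a%:C *: v) = a%:C *: f v).

Definition norm_on (Z : set V) (p : V -> R) : Prop :=
  [/\ forall v, Z v -> 0 <= p v,
      forall v, Z v -> p v = 0 -> v = 0,
      forall (a : R[i]) v, Z v -> p (a *: v) = rnorm a * p v &
      forall v w, Z v -> Z w -> p (v + w) <= p v + p w].

End linear_notions.

Section time_dependent_functions.
Variables (R : realType) (T : R).
Local Notation I := `[0, T]%classic.

(* Derivative along the real time variable of a function with values in a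
   complex normed space; one-sided at the end points of [0, T]. *)
Definition has_time_derivative (V : normedModType R[i]) (u u' : R -> V) : Prop :=
  forall t, I t ->
    ((s - t)^-1)%:C *: (u s - u t) @[s --> within I t^'] --> u' t.

Definition C1_in_time (V : normedModType R[i]) (u : R -> V) : Prop :=
  exists2 u' : R -> V, has_time_derivative u u' & {within I, continuous u'}.

(* f is C^1 on [0, T] x V with partial derivatives ft (time) and fx (state):
   joint Frechet differentiability, ft continuous, fx continuous for the
   operator norm.  Since time is real, V and W are regarded as real spaces and
   fx t v is only required to be R-linear. *)
Definition C1_with (V W : normedModType R[i])
    (f ft : R -> V -> W) (fx : R -> V -> V -> W) : Prop :=
  [/\ forall (t : R) (v : V), I t -> real_linear (fx t v) /\ (opnorm (fx t v) < +oo)%E,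
      forall (t : R) (v : V), I t -> forall e : R, 0 < e ->
        \forall p \near within (I `*` setT) (nbhs (t, v)),
          rnorm (f p.1 p.2 - f t v - (p.1 - t)%:C *: ft t v
                 - fx t v (p.2 - v))
          <= e * (`|p.1 - t| + rnorm (p.2 - v)),
      {within I `*` setT, continuous (fun p : R * V => ft p.1 p.2)} &
      forall (t : R) (v : V), I t -> forall e : R, 0 < e ->
        \forall p \near within (I `*` setT) (nbhs (t, v)),
          (opnorm (fun z : V => fx p.1 p.2 z - fx t v z)%R <= e%:E)%E].

Definition C1 (V W : normedModType R[i]) (f : R -> V -> W) : Prop :=
  exists ft fx, C1_with f ft fx.

End time_dependent_functions.

Section semigroups.
Variables (R : realType) (V : normedModType R[i]).
Implicit Types S : R -> V -> V.

Definition C0_semigroup S : Prop :=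
  [/\ forall t, 0 <= t -> linear (S t) /\ continuous (S t),
      forall v, S 0 v = v,
      forall s t v, 0 <= s -> 0 <= t -> S (s + t) v = S s (S t v) &
      forall v, S t v @[t --> 0^'+] --> v].

(* The restriction of A to D is the infinitesimal generator of S. *)
Definition generates (D : set V) (A : V -> V) S : Prop :=
  forall v w, (D v /\ A v = w) <->
    ((t^-1)%:C *: (S t v - v) @[t --> 0^'+] --> w).

(* The growth bound of S; it is -oo for instance when S is nilpotent. *)
Definition semigroup_type S : \bar R :=
  ereal_inf [set w%:E | w in [set w : R | exists M : R, forall t, 0 <= t ->
    (opnorm (S t) <= (M * expR (w * t))%:E)%E]].

End semigroups.

Section matrices.
Variables (R : realType) (n : nat).
Implicit Types M : 'M[R[i]]_n.

(* The norm of 'cV_n is the maximum norm, so this is the induced norm. *)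
Definition mxopnorm M : \bar R := opnorm (fun v : 'cV[R[i]]_n => M *m v).

Definition expmx M : 'M[R[i]]_n :=
  limn (series (fun j : nat => (j`!%:R : R[i])^-1 *: M ^+ j)).

End matrices.

Definition grid_values (R : realType) (d : nat) (O : bounded_domain R d)
    (n : nat) (x : 'I_n -> closure (O : set 'rV[R]_d)) (u : Cbar O)
  : 'cV[R[i]]_n := \col_i Cbar_fun u (x i).

(* One step of size k from (t, U0) of the Lawson method with explicit tableau
   (a, b, c) for U' = M U + F(t, U): lawson_stage gives the right-hand side of
   the equation defining the i-th stage, which only involves Ks j for j < i. *)
Section lawson.
Variables (R : realType) (n s : nat).
Variables (a : 'I_s -> 'I_s -> R) (b c : 'I_s -> R).
Variables (M : 'M[R[i]]_n) (F : R -> 'cV[R[i]]_n -> 'cV[R[i]]_n).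
Variables (k t : R) (U0 : 'cV[R[i]]_n) (Ks : 'I_s -> 'cV[R[i]]_n).

Definition lawson_stage (i : 'I_s) : 'cV[R[i]]_n :=
  expmx ((c i * k)%:C *: M) *m U0 +
  k%:C *: \sum_(j < s | (j < i)%N)
    (a i j)%:C *: (expmx (((c i - c j) * k)%:C *: M) *m F (t + c j * k) (Ks j)).

Definition lawson_step : 'cV[R[i]]_n :=
  expmx (k%:C *: M) *m U0 +
  k%:C *: \sum_(i < s)
    (b i)%:C *: (expmx (((1 - c i) * k)%:C *: M) *m F (t + c i * k) (Ks i)).

End lawson.

(* Main.v *)
(* The only dangerous terms are k e^{(c_i - c_j) k A_{h,0}} C_h g.  Writing
   C_h g = A_{h,0} (A_{h,0}^{-1} C_h g), the parabolic bound with
   tau = (c_i - c_j) k > 0 turns them into O(1) terms, with constant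
   C' C'' |g| / (c_i - c_j); for the last step the factor is 1 - c_i > 0.  The
   values f(t, K_j) are controlled by f(t, u(t)) and the bound L on the state
   derivative along the segment from P_h u(t) to K_j.  Hence stages and local
   error are O(1).  After multiplication by A_{h,0}^{-1} the boundary terms are
   bounded without parabolicity, so the whole sum is O(k); the remaining parts
   A_{h,0}^{-1} (e^{k A_{h,0}} - 1) P_h u(t_n) and A_{h,0}^{-1} P_h (u(t_{n+1}) -
   u(t_n)) are O(k) by the mean value inequality. *)

Require Import Defs.
From HB Require Import structures.
From mathcomp Require Import all_boot all_order all_algebra.
From mathcomp Require Import all_classical all_reals all_analysis.
From mathcomp Require Import ring lra.
From mathcomp.real_closed Require Import complex.

Set Implicit Arguments.
Unset Strict Implicit.
Unset Printing Implicit Defensive.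

Import Order.TTheory GRing.Theory Num.Theory numFieldNormedType.Exports.

Local Open Scope classical_set_scope.
Local Open Scope complex_scope.
Local Open Scope ring_scope.

(** * The real-valued norm on complex normed spaces *)

Section rnorm_facts.
Variables (R : rcfType) (V : normedModType R[i]).
Implicit Types (v w : V) (a : R[i]).

Lemma rnorm0 : rnorm (0 : V) = 0.
Proof. by rewrite /rnorm normr0. Qed.

Lemma rnormN v : rnorm (- v) = rnorm v.
Proof. by rewrite /rnorm normrN. Qed.

Lemma rnormB v w : rnorm (v - w) <= rnorm v + rnorm w.
Proof. by rewrite (le_trans (rnormD _ _)) ?rnormN. Qed.

Lemma rdistC v w : rnorm (v - w) = rnorm (w - v).
Proof. by rewrite -rnormN opprB. Qed.

Lemma rnormZ a v : rnorm (a *: v) = rnorm a * rnorm v.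
Proof. by apply: (@complexI R); rewrite rmorphM /= -!rnormE normrZ. Qed.

Lemma rnormCr (x : R) : rnorm (x%:C : R[i]) = `|x|.
Proof. by rewrite /rnorm normc_def /= expr0n /= addr0 sqrtr_sqr. Qed.

Lemma rnormZr (x : R) v : rnorm (x%:C *: v) = `|x| * rnorm v.
Proof. by rewrite rnormZ rnormCr. Qed.

Lemma rnorm_sum (I : Type) (r : seq I) (P : pred I) (F : I -> V) :
  rnorm (\sum_(i <- r | P i) F i) <= \sum_(i <- r | P i) rnorm (F i).
Proof.
elim/big_rec2: _ => [|i x y _ xy]; first by rewrite rnorm0.
by rewrite (le_trans (rnormD _ _))// lerD2l.
Qed.

Lemma rnorm_le0 v : rnorm v <= 0 -> v = 0.
Proof.
by move=> v0; apply: rnorm0_eq0; apply/eqP; rewrite eq_le v0 rnorm_ge0.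
Qed.

(** Library radii are positive elements of [R[i]]; positivity forces their imaginary part to vanish,
    so real radii suffice. *)
Lemma rnorm_cvgP (T : Type) (F : set_system T) (FF : Filter F) (u : T -> V) v :
  u x @[x --> F] --> v <->
  forall e : R, 0 < e -> \forall x \near F, rnorm (v - u x) < e.
Proof.
split=> [/cvgrPdist_lt uv e e0|uv].
  have e0C : 0 < e%:C by rewrite -[0]/(0%:C) ltcR.
  by near=> x; rewrite -ltcR -rnormE; near: x; exact: uv.
apply/cvgrPdist_lt => e; rewrite ltcE /= => /andP[/eqP eI e0].
have -> : e = (complex.Re e)%:C by case: e eI {e0} => x y /= ->.
by near=> x; rewrite rnormE ltcR; near: x; exact: uv.
Unshelve. all: by end_near. Qed.

End rnorm_facts.

Lemma rnorm_scalar1 (R : rcfType) : rnorm (1 : R[i]) = 1.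
Proof. by rewrite /rnorm normr1. Qed.

Lemma ler_Re_rnorm (R : rcfType) (z : R[i]) : `|complex.Re z| <= rnorm z.
Proof. by rewrite -lecR -rnormE normc_ge_Re. Qed.

Lemma rnorm_i (R : rcfType) : rnorm ('i%C : R[i]) = 1.
Proof. by rewrite /rnorm normc_def /= expr0n add0r expr1n sqrtr1. Qed.

Lemma ler_Im_rnorm (R : rcfType) (z : R[i]) : `|complex.Im z| <= rnorm z.
Proof.
by rewrite -normrN -ReiNIm (le_trans (ler_Re_rnorm _))// rnormM rnorm_i mulr1.
Qed.

Lemma ler_rnorm_ReIm (R : rcfType) (z : R[i]) :
  rnorm z <= `|complex.Re z| + `|complex.Im z|.
Proof.
rewrite {1}[z]complexE (le_trans (rnormD _ _))//.
by rewrite rnormM !rnormCr rnorm_i mul1r.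
Qed.

(** * The operator norm as a pointwise bound *)

Section operator_norm.
Variables (R : realType) (V W : normedModType R[i]).

(** Rescale [v] to norm one; a zero [v] is written [0%:C *: v]. Only real homogeneity is asked, so
    that the bound applies to real-linear state derivatives. *)
Lemma opnorm_le (F : V -> W) (m : R) :
  (forall (x : R) v, F (x%:C *: v) = x%:C *: F v) ->
  (opnorm F <= m%:E)%E -> forall v, rnorm (F v) <= m * rnorm v.
Proof.
move=> FZ Fm v.
have Fle w : rnorm w <= 1 -> rnorm (F w) <= m.
  move=> w1; rewrite -lee_fin; apply: le_trans Fm.
  by apply: ereal_sup_ubound; exists w.
have [v0|v0] := eqVneq (rnorm v) 0.
  have -> : v = 0%:C *: v by rewrite scale0r; exact: rnorm0_eq0.
  by rewrite FZ !rnormZr normr0 !mul0r mulr0.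
have vp : 0 < rnorm v by rewrite lt_neqAle eq_sym v0 rnorm_ge0.
have := Fle ((rnorm v)^-1%:C *: v).
rewrite FZ !rnormZr ger0_norm ?invr_ge0 ?rnorm_ge0// mulVf// => /(_ (lexx _)).
by rewrite ler_pdivrMl// mulrC.
Qed.

End operator_norm.

(** * Mean value inequality for vector-valued functions of a real variable *)

Section mean_value_inequality.
Variables (R : realType) (V : normedModType R[i]).

(** Continuous induction: the supremum [c] of the points up to which the bound from [a] holds
    belongs to that set, by the local estimate to the left of [c]. If [c < b], the same estimate to
    the right of [c] contradicts the choice of [c]. *)
Lemma locally_lipschitz_dist (phi : R -> V) (a b m : R) : a <= b ->
  (forall t, a <= t <= b -> \forall s \near t, a <= s <= b ->
    rnorm (phi s - phi t) <= m * `|s - t|) ->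
  rnorm (phi b - phi a) <= m * (b - a).
Proof.
move=> ab phim.
pose E := [set x | a <= x <= b /\ rnorm (phi x - phi a) <= m * (x - a)].
have Ea : E a by split; rewrite ?lexx// !subrr rnorm0 mulr0.
have ubE : ubound E b by move=> x [/andP[]].
have supE : has_sup E by split; [exists a|exists b].
pose c := sup E.
have cI : a <= c <= b.
  by apply/andP; split; [apply: ub_le_sup => //; exists b|apply: ge_sup => //; exists a].
have /nbhs_ballP[d /= d0 cd] := phim _ cI.
have Ec : E c.
  split=> //; have [x Ex cx] := sup_adherent d0 supE.
  have xc : x <= c by apply: ub_le_sup => //; exists b.
  have [xI xm] := Ex.
  have := cd x; rewrite /ball/= ger0_norm ?subr_ge0// => /(_ _ xI).
  rewrite distrC ger0_norm ?subr_ge0// rdistC => xcm.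
  have -> : phi c - phi a = (phi c - phi x) + (phi x - phi a) by rewrite addrA subrK.
  rewrite (le_trans (rnormD _ _))// (le_trans (lerD (xcm _) xm)) ?ltrBlDr -?ltrBlDl//.
  by rewrite -mulrDr addrA subrK.
have [cb|bc] := ltP c b; last first.
  by have <- : c = b by [apply/eqP; rewrite eq_le bc andbT; case/andP: cI]; case: Ec.
(* A point strictly beyond [c], inside both the interval and the ball of radius [d]. *)
pose s := Num.min b (c + d / 2).
have cs : c < s by rewrite lt_min cb ltrDl divr_gt0.
have sd : s < c + d.
  rewrite (@le_lt_trans _ _ (c + d / 2))// ?ge_min ?lexx ?orbT// ltrD2l.
  by rewrite ltr_pdivrMr// ltr_pMr// ltr1n.
have sI : a <= s <= b.
  by rewrite ge_min lexx andbT (le_trans _ (ltW cs))//; case/andP: cI.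
suff Es : E s by have := ub_le_sup (ex_intro _ b ubE) Es; rewrite leNgt cs.
split=> //; have := cd s; rewrite /ball/= ltr0_norm ?subr_lt0// opprB.
rewrite ltrBlDl => /(_ sd sI); rewrite gtr0_norm ?subr_gt0// => scm.
have -> : phi s - phi a = (phi s - phi c) + (phi c - phi a) by rewrite addrA subrK.
rewrite (le_trans (rnormD _ _))// (le_trans (lerD scm Ec.2))//.
by rewrite -mulrDr addrA subrK.
Qed.

(** The slack [e] is what differentiability provides; the previous bound holds with [m + e] for
    every [e > 0], and division by [b - a > 0] lets [e] tend to zero. *)
Lemma mean_value_le (phi : R -> V) (a b m : R) : a <= b ->
  (forall t e, a <= t <= b -> 0 < e -> \forall s \near t, a <= s <= b ->
    rnorm (phi s - phi t) <= (m + e) * `|s - t|) ->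
  rnorm (phi b - phi a) <= m * (b - a).
Proof.
move=> ab phim; have [->|neq] := eqVneq b a.
  by rewrite !subrr rnorm0 mulr0.
have ba : 0 < b - a by rewrite subr_gt0 lt_neqAle eq_sym neq.
rewrite -ler_pdivrMr//; apply/ler_addgt0Pr => e e0.
rewrite ler_pdivrMr//; apply: locally_lipschitz_dist => // t tI.
exact: phim.
Qed.

End mean_value_inequality.

(** * Derivatives in time on [0, T], their uniqueness and the resulting bounds *)

Section time_derivative.
Variables (R : realType) (T : R) (V : normedModType R[i]).
Hypothesis T_gt0 : 0 < T.
Implicit Types u : R -> V.

(** Multiplying the difference quotient by [s - t] removes the puncture at [s = t], giving the form
    that the mean value inequality consumes. *)
Lemma time_derivative_near u u' t e : has_time_derivative T u u' ->
  0 <= t <= T -> 0 < e -> \forall s \near t, 0 <= s <= T ->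
  rnorm (u s - u t - (s - t)%:C *: u' t) <= e * `|s - t|.
Proof.
move=> du tI e0.
have It : `[0, T]%classic t by rewrite /= in_itv.
have /rnorm_cvgP := du t It => /(_ e e0).
rewrite near_withinE /dnbhs near_withinE; apply: filterS => s /= su sI.
have [->|st] := eqVneq s t; first by rewrite !subrr scale0r subr0 rnorm0 normr0 mulr0.
have st0 : s - t != 0 by rewrite subr_eq0.
have {su} := su st; rewrite in_itv/= sI => /(_ isT) /ltW.
rewrite rdistC => H.
have -> : u s - u t - (s - t)%:C *: u' t =
    (s - t)%:C *: ((s - t)^-1%:C *: (u s - u t) - u' t).
  by rewrite scalerBr scalerA -rmorphM /= divff// scale1r.
by rewrite rnormZr mulrC ler_wpM2r.
Qed.

Lemma time_derivative_lipschitz u u' m : has_time_derivative T u u' ->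
  (forall t, 0 <= t <= T -> rnorm (u' t) <= m) ->
  forall a b, 0 <= a -> a <= b -> b <= T -> rnorm (u b - u a) <= m * (b - a).
Proof.
move=> du u'm a b a0 ab bT; apply: mean_value_le => // t e /andP[at_ tb] e0.
have tI : 0 <= t <= T by rewrite (le_trans a0 at_) (le_trans tb bT).
have := time_derivative_near du tI e0; apply: filterS => s H /andP[as_ sb].
have -> : u s - u t = (s - t)%:C *: u' t + (u s - u t - (s - t)%:C *: u' t).
  by rewrite [RHS]addrC subrK.
rewrite (le_trans (rnormD _ _))// rnormZr mulrDl lerD//.
  by rewrite mulrC ler_wpM2r// u'm.
by apply: H; rewrite (le_trans a0 as_) (le_trans sb bT).
Qed.

(** No point of [0, T] is isolated since [T > 0]; this makes one-sided derivatives unique, including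
    at the end points. *)
Lemma near_itv_neq t (P : R -> Prop) : 0 <= t <= T -> (\forall s \near t, P s) ->
  exists s, [/\ s != t, 0 <= s <= T & P s].
Proof.
move=> /andP[t0 tT] /nbhs_ballP[d /= d0 dP].
pose r := Num.min (d / 2) (T / 2).
have r0 : 0 < r by rewrite lt_min !divr_gt0.
have rd : r < d.
  rewrite (@le_lt_trans _ _ (d / 2))// ?ge_min ?lexx//; lra.
have rT : r <= T / 2 by rewrite ge_min lexx orbT.
(* Move right from the left half and left from the right half: a shift of at most [T / 2] stays
   inside. *)
have [tT2|tT2] := leP t (T / 2).
- exists (t + r); split; [lra|lra|apply: dP].
  by rewrite /ball/= opprD addrA subrr add0r normrN gtr0_norm.
- exists (t - r); split; [lra|lra|apply: dP].
  by rewrite /ball/= opprB addrC subrK gtr0_norm.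
Qed.

Lemma time_derivative_unique u u1 u2 : has_time_derivative T u u1 ->
  has_time_derivative T u u2 -> forall t, 0 <= t <= T -> u1 t = u2 t.
Proof.
move=> du1 du2 t tI; apply/eqP; rewrite -subr_eq0; apply/eqP/rnorm_le0.
apply/ler_addgt0Pr => e e0; rewrite add0r.
have e20 : 0 < e / 2 by rewrite divr_gt0.
have [s [st sI [/(_ sI) H1 /(_ sI) H2]]] := near_itv_neq tI (filterI
  (time_derivative_near du1 tI e20) (time_derivative_near du2 tI e20)).
have st0 : 0 < `|s - t| by rewrite normr_gt0 subr_eq0.
rewrite -(ler_pM2l st0) -rnormZr scalerBr.
set x := u s - u t in H1 H2.
have -> : (s - t)%:C *: u1 t - (s - t)%:C *: u2 t =
   (x - (s - t)%:C *: u2 t) - (x - (s - t)%:C *: u1 t).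
  by rewrite opprB [RHS]addrC addrA subrK.
rewrite (le_trans (rnormB _ _))// (le_trans (lerD H2 H1))//; lra.
Qed.

Lemma within_continuous_bounded u : {within `[0, T], continuous u} ->
  exists m, forall t, 0 <= t <= T -> rnorm (u t) <= m.
Proof.
move=> cu.
have cr : {within `[0, T], continuous (@rnorm R V \o u)}.
  by apply: within_continuous_comp => // v _; exact: rnorm_continuous.
have [c _ cm] := EVT_max (ltW T_gt0) cr.
by exists (rnorm (u c)) => t tI; apply: cm; rewrite in_itv.
Qed.

Lemma C1_in_time_lipschitz u : C1_in_time T u -> exists m, forall a b,
  0 <= a -> a <= b -> b <= T -> rnorm (u b - u a) <= m * (b - a).
Proof.
move=> [u' du /within_continuous_bounded[m u'm]].
by exists m; exact: time_derivative_lipschitz du u'm.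
Qed.

Lemma C1_in_time_bounded u : C1_in_time T u ->
  exists m, forall t, 0 <= t <= T -> rnorm (u t) <= m.
Proof.
move=> [u' du /within_continuous_bounded[m u'm]].
exists (m * T + rnorm (u 0)) => t /andP[t0 tT].
have m0 : 0 <= m by rewrite (le_trans (rnorm_ge0 (u' 0)))// u'm// lexx ltW.
rewrite -[u t](subrK (u 0)) (le_trans (rnormD _ _))// lerD2r.
have := time_derivative_lipschitz du u'm (lexx 0) t0 tT.
by move/le_trans; apply; rewrite subr0 ler_wpM2l.
Qed.

End time_derivative.

(** * Entrywise maximum norm of matrices and convergence of series *)

Section matrix_norm.
Variable R : realType.

Lemma rnorm_mx_ge m n (M : 'M[R[i]]_(m, n)) i j : rnorm (M i j) <= rnorm M.
Proof.
rewrite -lecR -!rnormE (_ : `|M| = mx_norm M)// mx_normE.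
have -> : `|M i j| = `|M (i, j).1 (i, j).2| by [].
by rewrite -[leLHS]nngE num_le; exact: le_bigmax.
Qed.

Lemma rnorm_mx_le m n (M : 'M[R[i]]_(m, n)) (e : R) : 0 <= e ->
  (forall i j, rnorm (M i j) <= e) -> rnorm M <= e.
Proof.
move=> e0 Me; have [M0|M0] := eqVneq (mx_norm M) 0.
  by rewrite /rnorm [X in complex.Re X]M0.
by have [[i j] /= ME] := mx_norm_neq0 M0; rewrite /rnorm [X in complex.Re X]ME Me.
Qed.

(** The norm here is the largest entry, not the induced norm, hence the factor [n]. Such
    dimension-dependent constants serve only for convergence and for remainders that vanish in the
    limit, so the final bounds stay independent of the grid. *)
Lemma rnorm_mulmx m n p (A : 'M[R[i]]_(m, n)) (B : 'M[R[i]]_(n, p)) :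
  rnorm (A *m B) <= n%:R * rnorm A * rnorm B.
Proof.
apply: rnorm_mx_le => [|i j]; first by rewrite !mulr_ge0 ?rnorm_ge0.
rewrite mxE (le_trans (rnorm_sum _ _ _))//.
rewrite (@le_trans _ _ (\sum_(k < n) rnorm A * rnorm B))//; last first.
  by rewrite sumr_const card_ord -mulrA mulr_natl.
by apply: ler_sum => k _; rewrite rnormM ler_pM ?rnorm_ge0 ?rnorm_mx_ge.
Qed.

Lemma rnorm_expr_mx n (M : 'M[R[i]]_n) j : rnorm (M ^+ j) <= (n%:R * rnorm M) ^+ j.
Proof.
elim: j => [|j IH].
  rewrite !expr0; apply: rnorm_mx_le => // i j; rewrite mxE.
  by case: (_ == _); rewrite ?rnorm_scalar1 ?rnorm0.
by rewrite !exprS (le_trans (rnorm_mulmx _ _))// ler_wpM2l// mulr_ge0// rnorm_ge0.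
Qed.

Lemma cvg_mulmx (T : Type) (F : set_system T) {FF : Filter F} m n p
    (A : 'M[R[i]]_(m, n)) (u : T -> 'M[R[i]]_(n, p)) l :
  u x @[x --> F] --> l -> A *m u x @[x --> F] --> A *m l.
Proof.
move=> /rnorm_cvgP ul; apply/rnorm_cvgP => e e0.
have c0 : 0 < n%:R * rnorm A + 1 by rewrite ltr_wpDl// mulr_ge0 ?rnorm_ge0.
near=> x; rewrite -mulmxBr (le_lt_trans (rnorm_mulmx _ _))//.
rewrite (@le_lt_trans _ _ ((n%:R * rnorm A + 1) * rnorm (l - u x)))//.
  by rewrite ler_wpM2r ?rnorm_ge0// lerDl.
rewrite mulrC -ltr_pdivlMr//; near: x; apply: ul; exact: divr_gt0.
Unshelve. all: by end_near. Qed.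

Lemma rnorm_lim_le (V : normedModType R[i]) (u : nat -> V) l (m : R) :
  u n @[n --> \oo] --> l -> (forall n, rnorm (u n) <= m) -> rnorm l <= m.
Proof.
move=> /rnorm_cvgP ul um; apply/ler_addgt0Pr => e /ul[N _ /(_ N (leqnn N)) le_].
rewrite -[l](subrK (u N)) (le_trans (rnormD _ _))// addrC lerD//; exact: ltW.
Qed.

(** Real and imaginary parts are dominated by the modulus, so each converges absolutely by
    comparison with [b]. *)
Lemma cvg_series_complex (z : nat -> R[i]) (b : R^nat) :
  (forall n, rnorm (z n) <= b n) -> cvgn (series b) -> cvgn (series z).
Proof.
move=> zb cb.
have b0 n : 0 <= b n := le_trans (rnorm_ge0 _) (zb n).
have cvg_part (p : R[i] -> R) : (forall x, `|p x| <= rnorm x) ->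
    cvgn (series (fun n => p (z n))).
  move=> px; apply: normed_cvg; apply: (series_le_cvg (fun=> normr_ge0 _) b0) cb => n /=.
  exact: le_trans (px _) (zb n).
have /cvg_ex[/= x cx] := cvg_part _ (@ler_Re_rnorm R).
have /cvg_ex[/= y cy] := cvg_part _ (@ler_Im_rnorm R).
apply/cvg_ex; exists (x +i* y); apply/rnorm_cvgP => e e0.
have e2 : 0 < e / 2 by rewrite divr_gt0.
move/cvgrPdist_lt : cx => /(_ _ e2) cx; move/cvgrPdist_lt : cy => /(_ _ e2) cy.
near=> n; rewrite (le_lt_trans (ler_rnorm_ReIm _))//.
have -> : complex.Re (x +i* y - series z n) = x - series (fun n => complex.Re (z n)) n.
  by rewrite raddfB/= /series/= raddf_sum.
have -> : complex.Im (x +i* y - series z n) = y - series (fun n => complex.Im (z n)) n.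
  by rewrite raddfB/= /series/= raddf_sum.
have -> : e = e / 2 + e / 2 by rewrite -splitr.
by rewrite ltrD//; near: n.
Unshelve. all: by end_near. Qed.

Lemma cvg_series_mx m n (M : nat -> 'M[R[i]]_(m, n)) (b : R^nat) :
  (forall j, rnorm (M j) <= b j) -> cvgn (series b) -> cvgn (series M).
Proof.
move=> Mb cb.
have ce i j : cvgn (series (fun k => M k i j)).
  apply: cvg_series_complex cb => k; exact: le_trans (rnorm_mx_ge _ _ _) (Mb k).
apply/cvg_ex; exists (\matrix_(i, j) limn (series (fun k => M k i j))).
apply/rnorm_cvgP => e e0; have e2 : 0 < e / 2 by rewrite divr_gt0.
(* There are finitely many entries, so one rank serves them all. *)
have H : \forall k \near \oo, forall i j,
    rnorm (limn (series (fun k => M k i j)) - series (fun k => M k i j) k) < e / 2.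
  apply: filter_forall => i; apply: filter_forall => j.
  by have /rnorm_cvgP := ce i j; exact.
near=> k; rewrite (@le_lt_trans _ _ (e / 2))//; last lra.
apply: rnorm_mx_le => [|i j]; first exact: ltW.
rewrite !mxE /series/= summxE; apply: ltW; move: i j; near: k; exact: H.
Unshelve. all: by end_near. Qed.

End matrix_norm.

(** * Second-order remainder of scalar powers *)

Section power_remainder.
Variable R : realDomainType.

(** Induction on [j]: the remainder is multiplied by [s] and gains
    [(s - t) ^+ 2 * t ^+ j * j.+1%:R]. The crude bound by powers of [4 * rho] is chosen so that
    division by factorials sums to an exponential. *)
Lemma expr_taylor1 (s t rho : R) j : 1 <= rho -> `|s| <= rho -> `|t| <= rho ->
  `|s ^+ j.+1 - t ^+ j.+1 - (s - t) * t ^+ j * j.+1%:R|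
    <= (s - t) ^+ 2 * (4 * rho) ^+ j.+1.
Proof.
move=> rho1 s_ t_; have rho0 : 0 <= rho by rewrite (le_trans _ rho1).
have d0 : 0 <= (s - t) ^+ 2 by exact: sqr_ge0.
elim: j => [|j IH].
  by rewrite !expr1 expr0 !mulr1 subrr normr0 mulr_ge0// mulr_ge0.
have -> : s ^+ j.+2 - t ^+ j.+2 - (s - t) * t ^+ j.+1 * j.+2%:R =
    s * (s ^+ j.+1 - t ^+ j.+1 - (s - t) * t ^+ j * j.+1%:R)
    + (s - t) ^+ 2 * t ^+ j * j.+1%:R.
  rewrite -(natr1 j.+1) !exprS; move: (j.+1%:R : R) (s ^+ j) (t ^+ j) => c x y.
  by ring.
have tj : `|t ^+ j| <= rho ^+ j by rewrite normrX lerXn2r ?nnegrE.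
have j4 : j.+1%:R <= 4 ^+ j.+1 :> R.
  by rewrite -natrX ler_nat ltnW// ltn_expl.
have p4 : 0 <= (4 : R) ^+ j.+1 by rewrite exprn_ge0.
have pr : 0 <= rho ^+ j by rewrite exprn_ge0.
rewrite (le_trans (ler_normD _ _))// normrM (normrM _ j.+1%:R).
rewrite (normrM (_ ^+ 2)) (ger0_norm d0) normr_nat.
rewrite (@le_trans _ _ (rho * ((s - t) ^+ 2 * (4 * rho) ^+ j.+1)
   + (s - t) ^+ 2 * (rho ^+ j * 4 ^+ j.+1)))//.
  by apply: lerD; [exact: ler_pM|rewrite -mulrA ler_wpM2l// ler_pM].
move: ((s - t) ^+ 2) d0 => x x0.
have -> : rho * (x * (4 * rho) ^+ j.+1) = x * (4 ^+ j.+1 * rho ^+ j) * (rho * rho).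
  by rewrite exprMn (exprS rho j); ring.
have -> : x * (4 * rho) ^+ j.+2 = x * (4 ^+ j.+1 * rho ^+ j) * (4 * (rho * rho)).
  by rewrite exprMn (exprS rho j.+1) (exprS rho j) (exprS 4 j.+1); ring.
have -> : x * (rho ^+ j * 4 ^+ j.+1) = x * (4 ^+ j.+1 * rho ^+ j) * 1 by ring.
have rr : 1 <= rho * rho by rewrite mulr_ege1.
rewrite -mulrDr ler_wpM2l ?mulr_ge0//.
lra.
Qed.

End power_remainder.

(** * The matrix exponential and its first-order expansion in time *)

Section matrix_exponential.
Variables (R : realType) (n : nat).
Implicit Types M : 'M[R[i]]_n.

Lemma rnorm_inv_fact j : rnorm ((j`!%:R : R[i])^-1) = j`!%:R^-1.
Proof.
have -> : (j`!%:R : R[i])^-1 = ((j`!%:R : R)^-1)%:C by rewrite fmorphV rmorph_nat.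
by rewrite rnormCr ger0_norm// invr_ge0.
Qed.

(** Comparison with the scalar exponential series at [n%:R * rnorm M]; this makes the [limn] in
    [expmx] a genuine limit. *)
Lemma expmx_cvg M :
  series (fun j : nat => (j`!%:R : R[i])^-1 *: M ^+ j) @ \oo --> expmx M.
Proof.
apply: (@cvg_series_mx _ _ _ _ (exp_coeff (n%:R * rnorm M))).
  move=> j; rewrite rnormZ rnorm_inv_fact /exp_coeff/= mulrC.
  by rewrite ler_wpM2r ?invr_ge0// rnorm_expr_mx.
exact: is_cvg_series_exp_coeff.
Qed.

(** Both products are limits of the same sequence, because [B] commutes with every power of [M]. *)
Lemma expmx_comm (B M : 'M[R[i]]_n) :
  B *m M = M *m B -> B *m expmx M = expmx M *m B.
Proof.
move=> BM; have BX j : B *m M ^+ j = M ^+ j *m B.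
  elim: j => [|j IH]; first by rewrite expr0 mulmx1 mul1mx.
  by rewrite exprS -mulmxE mulmxA BM -mulmxA IH mulmxA.
have H1 : B *m series (fun j : nat => (j`!%:R : R[i])^-1 *: M ^+ j) x
    @[x --> \oo] --> B *m expmx M by apply: cvg_mulmx; exact: expmx_cvg.
have H2 : series (fun j : nat => (j`!%:R : R[i])^-1 *: M ^+ j) x *m B
    @[x --> \oo] --> expmx M *m B.
  have := @expmx_cvg M => /rnorm_cvgP cM; apply/rnorm_cvgP => e e0.
  have c0 : 0 < n%:R * rnorm B + 1 by rewrite ltr_wpDl// mulr_ge0 ?rnorm_ge0.
  have := cM _ (divr_gt0 e0 c0); apply: filterS => x.
  rewrite ltr_pdivlMr// => H; rewrite -mulmxBl (le_lt_trans (rnorm_mulmx _ _))//.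
  by apply: le_lt_trans H; rewrite mulrAC mulrC ler_wpM2l ?rnorm_ge0// lerDl.
apply: (@cvg_unique _ (@norm_hausdorff _ 'M[R[i]]_n) _ _ _ _ H1).
apply: cvg_trans H2; apply: near_eq_cvg; near=> x.
rewrite /series/= mulmx_sumr mulmx_suml; apply: eq_bigr => j _.
by rewrite -scalemxAr -scalemxAl BX.
Unshelve. all: by end_near. Qed.

Lemma expmx0 : expmx (0 : 'M[R[i]]_n) = 1%:M.
Proof.
apply: (@cvg_unique _ (@norm_hausdorff _ 'M[R[i]]_n) _ _ _ _ (expmx_cvg (M := 0))).
apply: cvg_near_cst; near=> k.
have k0 : (0 < k)%N by near: k; exists 1%N.
rewrite /series/= big_ltn// expr0 fact0 invr1 scale1r big_nat_cond big1 ?addr0//.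
by move=> j /andP[/andP[j0 _] _]; rewrite expr0n gtn_eqF// scaler0.
Unshelve. all: by end_near. Qed.

Lemma exprZ_mx (x : R[i]) M j : (x *: M) ^+ j = x ^+ j *: M ^+ j.
Proof.
elim: j => [|j IH]; first by rewrite !expr0 scale1r.
by rewrite !exprS IH -!mulmxE -scalemxAl -scalemxAr scalerA.
Qed.

(** The scalar remainder bound is applied to each term of the partial sums, and the limit is taken
    afterwards. The quadratic remainder shows that the derivative of the exponential is [M] times
    it. *)
Lemma expmx_taylor1 M (s t rho : R) : 1 <= rho -> `|s| <= rho -> `|t| <= rho ->
  rnorm (expmx (s%:C *: M) - expmx (t%:C *: M)
         - (s - t)%:C *: (M *m expmx (t%:C *: M)))
  <= (s - t) ^+ 2 * expR (4 * rho * (n%:R * rnorm M)).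
Proof.
move=> rho1 s_ t_.
pose X (r : R) := series (fun j : nat => (j`!%:R : R[i])^-1 *: (r%:C *: M) ^+ j).
have cX r : X r k @[k --> \oo] --> expmx (r%:C *: M) := @expmx_cvg _.
have cXS r : X r k.+1 @[k --> \oo] --> expmx (r%:C *: M).
  by have := cX r; rewrite -(cvg_shiftS (X r)).
have H : X s k.+1 - X t k.+1 - (s - t)%:C *: (M *m X t k) @[k --> \oo] -->
    expmx (s%:C *: M) - expmx (t%:C *: M)
    - (s - t)%:C *: (M *m expmx (t%:C *: M)).
  by apply: cvgB; [exact: cvgB|apply: cvgZl_tmp; exact: cvg_mulmx].
apply: rnorm_lim_le H _ => k.
set y := 4 * rho * (n%:R * rnorm M).
have y0 : 0 <= y by rewrite !mulr_ge0 ?rnorm_ge0// (le_trans _ rho1).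
apply: (@le_trans _ _ ((s - t) ^+ 2 * series (exp_coeff y) k.+1)); last first.
  rewrite ler_wpM2l ?sqr_ge0//; apply: nondecreasing_cvgn_le.
    by apply: nondecreasing_series => j _ _; rewrite exp_coeff_ge0.
  exact: is_cvg_series_exp_coeff.
(* The constant terms cancel; the sums up to [k.+1] face [X t k] because multiplication by [M]
   raises the degree by one. *)
have -> : X s k.+1 - X t k.+1 - (s - t)%:C *: (M *m X t k) =
    \sum_(0 <= j < k) ((j.+1`!%:R : R[i])^-1 *
      (s ^+ j.+1 - t ^+ j.+1 - (s - t) * t ^+ j * j.+1%:R)%:C) *: M ^+ j.+1.
  rewrite /X /series/= !big_nat_recl// !expr0 opprD addrACA subrr add0r.
  rewrite mulmx_sumr scaler_sumr -!sumrB; apply: eq_bigr => j _.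
  rewrite !exprZ_mx -!scalemxAr mulmxE -exprS !scalerA -!scalerBl; congr (_ *: _).
  have jn0 : (j.+1`!%:R : R[i]) != 0 by rewrite pnatr_eq0 -lt0n fact_gt0.
  have -> : (j`!%:R : R[i])^-1 = (j.+1`!%:R)^-1 * j.+1%:R.
    rewrite factS natrM invfM mulrAC mulVf ?mul1r// pnatr_eq0//.
  rewrite !rmorphB !rmorphM !rmorphXn/= rmorphB rmorph_nat; ring.
rewrite (le_trans (rnorm_sum _ _ _))// /series/= big_nat_recl// mulrDr.
apply: ler_wpDl; first by rewrite mulr_ge0 ?sqr_ge0 ?exp_coeff_ge0.
rewrite mulr_sumr.
apply: ler_sum => j _; rewrite rnormZ rnormM rnorm_inv_fact rnormCr /exp_coeff/=.
rewrite [leLHS](_ : _ = `|s ^+ j.+1 - t ^+ j.+1 - (s - t) * t ^+ j * j.+1%:R|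
  * rnorm (M ^+ j.+1) / j.+1`!%:R); last by rewrite -mulrA mulrC -mulrA.
rewrite mulrA ler_wpM2r ?invr_ge0// exprMn mulrA.
by rewrite ler_pM ?rnorm_ge0 ?rnorm_expr_mx ?expr_taylor1.
Qed.

Lemma mxopnorm_le M (m : R) (v : 'cV[R[i]]_n) :
  (mxopnorm M <= m%:E)%E -> rnorm (M *m v) <= m * rnorm v.
Proof. by move=> Mm; apply: (opnorm_le _ Mm) => x w; rewrite -scalemxAr. Qed.

(** The curve [invmx M *m (expmx (t%:C *: M) *m v)] has derivative [expmx (t%:C *: M) *m v], of norm
    at most [rnorm v] by contractivity; conclude by the mean value inequality. *)
Lemma rnorm_invmx_expmx_sub1 M k (v : 'cV[R[i]]_n) : M \in unitmx ->
  (forall t, 0 <= t -> (mxopnorm (expmx (t%:C *: M)) <= 1)%E) -> 0 <= k ->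
  rnorm (invmx M *m (expmx (k%:C *: M) *m v - v)) <= k * rnorm v.
Proof.
move=> Mu M1 k0.
pose E t := expmx (t%:C *: M).
have Ele t : 0 <= t -> rnorm (E t *m v) <= rnorm v.
  by move=> t0; rewrite -[leRHS]mul1r; apply: mxopnorm_le; exact: M1.
pose phi t := invmx M *m (E t *m v).
have -> : invmx M *m (E k *m v - v) = phi k - phi 0.
  by rewrite /phi /E scale0r expmx0 mul1mx mulmxBr.
rewrite -[k in k * _]subr0 mulrC; apply: mean_value_le => // t e /andP[t0 tk] e0.
set rho := k + 1.
set m := expR (4 * rho * (n%:R * rnorm M)).
(* The remainder is at most [(s - t) ^+ 2 * q], so within radius [e / (q + 1)] it is below
   [e * |s - t|]; [q] affects only this radius. *)
pose q := n%:R * rnorm (invmx M) * (n%:R * m * rnorm v).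
have q0 : 0 <= q by rewrite !mulr_ge0 ?rnorm_ge0 ?expR_ge0.
have d0 : 0 < e / (q + 1) by rewrite divr_gt0// ltr_wpDl.
apply/nbhs_ballP; exists (e / (q + 1)) => //= s; rewrite /ball/= => ts /andP[s0 sk].
have rhok : 1 <= rho by rewrite /rho lerDr.
have sr : `|s| <= rho by rewrite ger0_norm// (le_trans sk)// lerDl.
have tr : `|t| <= rho by rewrite ger0_norm// (le_trans tk)// lerDl.
have := expmx_taylor1 M rhok sr tr; rewrite -/m -/(E s) -/(E t).
set r := E s - E t - _ => rle.
have -> : phi s - phi t = (s - t)%:C *: (E t *m v) + invmx M *m (r *m v).
  rewrite /phi -mulmxBr -mulmxBl.
  have -> : E s - E t = r + (s - t)%:C *: (M *m E t) by rewrite subrK.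
  by rewrite mulmxDl mulmxDr addrC -scalemxAl -scalemxAr !mulmxA mulVmx// mul1mx.
rewrite (le_trans (rnormD _ _))// mulrDl lerD//.
  by rewrite rnormZr mulrC ler_wpM2r// Ele.
rewrite (le_trans (rnorm_mulmx _ _))//.
rewrite (@le_trans _ _ ((s - t) ^+ 2 * q))//.
  rewrite /q mulrCA ler_wpM2l ?mulr_ge0 ?rnorm_ge0//.
  rewrite (le_trans (rnorm_mulmx _ _))// [leRHS]mulrA ler_wpM2r ?rnorm_ge0//.
  by rewrite [leRHS]mulrCA ler_wpM2l.
rewrite -real_normK ?num_real// expr2 -mulrA mulrC ler_wpM2r//.
move: ts; rewrite distrC ltr_pdivlMr ?ltr_wpDl// => /ltW; apply: le_trans.
by rewrite ler_wpM2l// lerDl.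
Qed.

End matrix_exponential.

(** * Exponentials applied to boundary and source terms *)

Section forced_terms.
Variables (R : realType) (n : nat) (M : 'M[R[i]]_n).
Hypothesis M_unit : M \in unitmx.
Hypothesis M_contractive :
  forall t, 0 <= t -> (mxopnorm (expmx (t%:C *: M)) <= 1)%E.

Lemma rnorm_expmx_le t (v : 'cV[R[i]]_n) : 0 <= t ->
  rnorm (expmx (t%:C *: M) *m v) <= rnorm v.
Proof.
by move=> t0; rewrite -[leRHS]mul1r; apply: mxopnorm_le; exact: M_contractive.
Qed.

(* Writing [w = M *m (invmx M *m w)], the parabolic bound absorbs the factor M
   at the price of one power of k. *)
Lemma rnorm_forced_term (C' G F p k : R) (w z : 'cV[R[i]]_n) :
  0 <= C' -> 0 < p -> 0 <= k ->
  (mxopnorm ((p * k)%:C *: (M *m expmx ((p * k)%:C *: M))) <= C'%:E)%E ->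
  rnorm (invmx M *m w) <= G -> rnorm z <= F ->
  rnorm (k%:C *: (expmx ((p * k)%:C *: M) *m (w + z))) <= C' * G / p + k * F.
Proof.
move=> C'0 p0 k0 parab wG zF; set E := expmx _.
have EM : E *m M = M *m E.
  by symmetry; apply: expmx_comm; rewrite -scalemxAr -scalemxAl.
(* The factor [k] is split as [p^-1 * (p * k)], so that the parabolic bound applies with time
   [p * k]. *)
have -> : k%:C *: (E *m (w + z)) =
    p^-1%:C *: ((p * k)%:C *: (M *m E) *m (invmx M *m w)) + k%:C *: (E *m z).
  rewrite mulmxDr scalerDr -EM; congr (_ + _).
  rewrite -scalemxAl scalerA -rmorphM /= mulrA mulVf ?gt_eqF// mul1r.
  by rewrite -mulmxA mulKVmx.
rewrite (le_trans (rnormD _ _))// !rnormZr lerD//.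
  have pV0 : 0 <= p^-1 by rewrite invr_ge0 ltW.
  rewrite ger0_norm// [leLHS]mulrC ler_wpM2r//.
  by rewrite (le_trans (mxopnorm_le _ parab))// ler_wpM2l.
rewrite ger0_norm// ler_wpM2l// (le_trans _ zF)// rnorm_expmx_le//.
by rewrite mulr_ge0// ltW.
Qed.

(** The inverse of [M] commutes with the exponential and falls directly on [w], so contractivity
    alone controls the boundary part. *)
Lemma rnorm_invmx_forced_term (C G F t : R) (w z : 'cV[R[i]]_n) :
  0 <= C -> 0 <= t -> (mxopnorm (invmx M) <= C%:E)%E ->
  rnorm (invmx M *m w) <= G -> rnorm z <= F ->
  rnorm (invmx M *m (expmx (t%:C *: M) *m (w + z))) <= G + C * F.
Proof.
move=> C0 t0 MC wG zF; set E := expmx _.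
have -> : invmx M *m (E *m (w + z)) = E *m (invmx M *m w) + invmx M *m (E *m z).
  rewrite !mulmxDr; congr (_ + _); rewrite !mulmxA; congr (_ *m _).
  by apply: expmx_comm; rewrite -scalemxAr -scalemxAl mulmxV ?mulVmx.
rewrite (le_trans (rnormD _ _))// lerD//.
  by rewrite (le_trans _ wG)// rnorm_expmx_le.
by rewrite (le_trans (mxopnorm_le _ MC))// ler_wpM2l// (le_trans _ zF)// rnorm_expmx_le.
Qed.

End forced_terms.

(** Mean value inequality on [0, 1] along the segment from [v] to [w], with time frozen at [t]. *)
Lemma C1_with_segment (R : realType) (T : R) (V W : normedModType R[i])
    (f ft : R -> V -> W) (fx : R -> V -> V -> W) (t L : R) (v w : V) :
  C1_with T f ft fx -> 0 <= t <= T ->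
  (forall theta : R, 0 <= theta <= 1 ->
     (opnorm (fx t (v + theta%:C *: (w - v))%R) <= L%:E)%E) ->
  rnorm (f t w - f t v) <= L * rnorm (w - v).
Proof.
move=> [fx_lin fD _ _] tI fxL.
have It : `[0, T]%classic t by rewrite /= in_itv.
set d := w - v in fxL *.
pose x (r : R) : V := v + r%:C *: d.
have -> : f t w - f t v = f t (x 1) - f t (x 0).
  by rewrite /x scale0r scale1r addr0 /d (addrC v) subrK.
have := mean_value_le (phi := fun r => f t (x r)) (m := L * rnorm d) ler01.
rewrite subr0 mulr1; apply.
move=> r e /fxL fxr e0.
have xr : x s @[s --> r] --> x r.
  apply/rnorm_cvgP => e1 e10; have D1 : 0 < rnorm d + 1 by rewrite ltr_wpDl// rnorm_ge0.
  apply/nbhs_ballP; exists (e1 / (rnorm d + 1)) => /=; first exact: divr_gt0.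
  move=> s; rewrite /ball/= ltr_pdivlMr//; apply: le_lt_trans.
  rewrite /x opprD addrACA subrr add0r -scalerBl -rmorphB rnormZr.
  by rewrite ler_wpM2l// lerDl.
have xcvg : (t, x s) @[s --> r] --> (t, x r).
  exact: (@cvg_pair _ _ _ (nbhs r) (nbhs t) (nbhs (x r)) _ _ _ _ _ (cvg_cst t) xr).
have D1 : 0 < rnorm d + 1 by rewrite ltr_wpDl// rnorm_ge0.
(* Joint differentiability pulled back along [s] to [(t, x s)]. The tolerance is divided by
   [rnorm d + 1] because [x s - x r] has norm [|s - r| * rnorm d]. *)
have near_r : \forall s \near r,
    rnorm (f t (x s) - f t (x r) - (t - t)%:C *: ft t (x r)
           - fx t (x r) (x s - x r))
    <= e / (rnorm d + 1) * (`|t - t| + rnorm (x s - x r)).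
  have := fD t (x r) It _ (divr_gt0 e0 D1); rewrite near_withinE => /xcvg.
  by apply: (@filterS _ (nbhs r)) => s; apply.
apply: filterS near_r => s H _.
have [[_ fxZ] _] := fx_lin t (x r) It.
have xsr : x s - x r = (s - r)%:C *: d.
  by rewrite /x opprD addrACA subrr add0r -scalerBl -rmorphB.
move: H; rewrite subrr normr0 scale0r subr0 add0r xsr fxZ rnormZr => H.
rewrite -[f t (x s) - _](subrK ((s - r)%:C *: fx t (x r) d)).
rewrite (le_trans (rnormD _ _))// [leRHS]mulrDl [leRHS]addrC lerD//.
  rewrite (le_trans H)// [leLHS]mulrCA [leLHS]mulrC ler_wpM2r// mulrAC ler_pdivrMr//.
  by rewrite ler_wpM2l ?ltW// ltrDl.
by rewrite rnormZr [leLHS]mulrC ler_wpM2r// (opnorm_le fxZ).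
Qed.

(** * Restriction to the grid *)

Section grid_values_facts.
Variables (R : realType) (d : nat) (O : bounded_domain R d) (n : nat).
Variable x : 'I_n -> closure (O : set 'rV[R]_d).

Lemma rnorm_grid_values (u : Cbar O) : rnorm (grid_values x u) <= rnorm u.
Proof.
have un : rnorm u = Cbar_norm u by [].
apply: rnorm_mx_le => [|i j]; first exact: rnorm_ge0.
by rewrite mxE un Cbar_norm_ge.
Qed.

Lemma grid_valuesB (u v : Cbar O) :
  grid_values x (u - v) = grid_values x u - grid_values x v.
Proof. by apply/matrixP => i j; rewrite !mxE. Qed.

End grid_values_facts.

Lemma linear_scale (K : pzRingType) (V W : lmodType K) (F : V -> W) :
  linear F -> forall a v, F (a *: v) = a *: F v.
Proof.
move=> Flin a v; have F0 : F 0 = 0.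
  have := Flin 1 0 0; rewrite !scale1r addr0 => /eqP.
  by rewrite -subr_eq0 opprD addrA subrr add0r oppr_eq0 => /eqP.
by have := Flin a v 0; rewrite addr0 F0 addr0.
Qed.

(** * Uniform bounds for the stages and the local error *)

Theorem theorem4
  (* continuous problem *)
  (R : realType) (d : nat) (Omega : bounded_domain R d)
  (Y : completeNormedModType R[i])
  (D : set (Cbar Omega)) (A : Cbar Omega -> Cbar Omega) (B : Cbar Omega -> Y)
  (D_subspace : linear_subspace D)
  (A_linear : linear_on D A) (B_linear : linear_on D B)
  (T : R) (T_gt0 : 0 < T)
  (f : R -> Cbar Omega -> Cbar Omega) (g : R -> Y)
  (u0 : Cbar Omega) (u : R -> Cbar Omega)
  (u_initial : u 0 = u0)
  (u_equation : has_time_derivative T u (fun t => A (u t) + f t (u t)))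
  (u_boundary : forall t, t \in `[0, T] -> B (u t) = g t)
  (* (i) *)
  (B_onto : forall v : Y, exists2 x, D x & B x = v)
  (g_C1 : C1_in_time T g)
  (* (ii), with S t = exp(t A_0) *)
  (S : R -> Cbar Omega -> Cbar Omega)
  (kerB_dense : dense (D `&` [set x | B x = 0]))
  (S_semigroup : C0_semigroup S)
  (S_generator : generates (D `&` [set x | B x = 0]) A S)
  (S_negative_type : (semigroup_type S < 0)%E)
  (* (iii) *)
  (K : R[i] -> Y -> Cbar Omega) (omega0 CK : R)
  (K_solution : forall z v, 0 < complex.Re z ->
     [/\ D (K z v), A (K z v) = z *: K z v & B (K z v) = v])
  (K_unique : forall z v x, 0 < complex.Re z ->
     D x -> A x = z *: x -> B x = v -> x = K z v)
  (omega0_gt_type : (semigroup_type S < omega0%:E)%E)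
  (K_bounded : forall z v, 0 < complex.Re z -> omega0 <= complex.Re z ->
     rnorm (K z v) <= CK * rnorm v)
  (* (iv) *)
  (f_C1 : C1 T f)
  (* (v) *)
  (u_C1 : C1_in_time T u)
  (u_domain : forall t, t \in `[0, T] -> D (u t))
  (Au_continuous : {within `[0, T], continuous (fun t => A (u t))})
  (* space discretization: H is the set of mesh parameters *)
  (H : set R) (H_pos : forall h, H h -> 0 < h)
  (N : R -> nat)
  (grid : forall h, 'I_(N h) -> closure (Omega : set 'rV[R]_d))
  (grid_inj : forall h, H h -> injective (grid h))
  (A0 : forall h, 'M[R[i]]_(N h)) (Ch : forall h, Y -> 'cV[R[i]]_(N h))
  (Ch_linear : forall h, H h -> linear (Ch h))
  (fh : forall h, R -> 'cV[R[i]]_(N h) -> 'cV[R[i]]_(N h))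
  (fh_restriction : forall h t (v : Cbar Omega), H h -> t \in `[0, T] ->
     grid_values (grid h) (f t v) = fh h t (grid_values (grid h) v))
  (* (a) *)
  (A0_contractive : forall h t, H h -> 0 <= t ->
     (mxopnorm (expmx (t%:C *: A0 h)) <= 1)%E)
  (A0_unit : forall h, H h -> A0 h \in unitmx)
  (C : R)
  (A0_inv_bounded : forall h, H h -> (mxopnorm (invmx (A0 h)) <= C%:E)%E)
  (* (b) *)
  (Rh : forall h, Cbar Omega -> 'cV[R[i]]_(N h))
  (Rh_def : forall h x, H h -> D x ->
     A0 h *m Rh h x + Ch h (B x) = grid_values (grid h) (A x))
  (Z : set (Cbar Omega)) (normZ : Cbar Omega -> R)
  (Z_subspace : linear_subspace Z) (Z_sub_D : Z `<=` D)
  (normZ_norm : norm_on Z normZ)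
  (Z_A0_inv : forall x, Z x -> exists w, [/\ Z w, B w = 0 & A w = x])
  (Z_semigroup : forall t x, t \in `[0, T] -> Z x -> Z (S t x))
  (Z_f : forall t x, t \in `[0, T] -> Z x -> Z (f t x))
  (eps eta : R -> R)
  (eps_small : eps h @[h --> within H 0^'+] --> 0)
  (eta_small : eta h @[h --> within H 0^'+] --> 0)
  (consistency_A0 : forall h x, H h -> Z x ->
     rnorm (A0 h *m (grid_values (grid h) x - Rh h x)) <= eps h * normZ x)
  (consistency : forall h x, H h -> Z x ->
     rnorm (grid_values (grid h) x - Rh h x) <= eta h * normZ x)
  (C'' : R)
  (A0_inv_Ch_bounded : forall h, H h ->
     (opnorm (fun v : Y => invmx (A0 h) *m Ch h v) <= C''%:E)%E)
  (* Lawson method with explicit tableau (a, b, c) *)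
  (s : nat) (a : 'I_s -> 'I_s -> R) (b c : 'I_s -> R)
  (c_range : forall i, 0 <= c i <= 1)
  (h0 k0 : R) (h0_gt0 : 0 < h0) (k0_gt0 : 0 < k0)
  (Kbar : forall h, R -> nat -> 'I_s -> 'cV[R[i]]_(N h))
  (Kbar_def : forall h k n i, H h -> h <= h0 ->
     0 < k -> k <= k0 -> n.+1%:R * k <= T ->
     Kbar h k n i =
       lawson_stage a c (A0 h) (fun t V => Ch h (g t) + fh h t V)
         k (n%:R * k) (grid_values (grid h) (u (n%:R * k))) (Kbar h k n) i)
  (* (c), with nbh h t the section at time t of the neighbourhood *)
  (fht : forall h, R -> 'cV[R[i]]_(N h) -> 'cV[R[i]]_(N h))
  (fhx : forall h, R -> 'cV[R[i]]_(N h) -> 'cV[R[i]]_(N h) -> 'cV[R[i]]_(N h))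
  (fh_C1 : forall h, H h -> C1_with T (fh h) (fht h) (fhx h))
  (nbh : forall h, R -> set 'cV[R[i]]_(N h)) (delta L : R)
  (delta_gt0 : 0 < delta)
  (nbh_ball : forall h t V, H h -> t \in `[0, T] ->
     rnorm (V - grid_values (grid h) (u t)) < delta -> nbh h t V)
  (nbh_star : forall h t V (theta : R), H h -> t \in `[0, T] -> nbh h t V ->
     0 <= theta <= 1 ->
     nbh h t (grid_values (grid h) (u t)
              + theta%:C *: (V - grid_values (grid h) (u t))))
  (fhx_bounded : forall h t V, H h -> t \in `[0, T] -> nbh h t V ->
     (opnorm (fhx h t V) <= L%:E)%E)
  (Kbar_stays : forall h k n i, H h -> h <= h0 ->
     0 < k -> k <= k0 -> n.+1%:R * k <= T ->
     nbh h (n%:R * k + c i * k) (Kbar h k n i))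
  (* hypotheses specific to the theorem *)
  (boundary_nonzero : exists2 t, t \in `[0, T] & B (u t) != 0)
  (c_increasing : forall i j : 'I_s, (i < j)%N -> c i < c j)
  (c_neq1 : forall i, c i != 1)
  (C' : R)
  (A0_parabolic : forall h tau, H h -> h <= h0 -> 0 <= tau ->
     (mxopnorm (tau%:C *: (A0 h *m expmx (tau%:C *: A0 h))) <= C'%:E)%E) :
  exists M : R, forall h k n, H h -> h <= h0 ->
    0 < k -> k <= k0 -> n.+1%:R * k <= T ->
    let Ubar :=
      lawson_step b c (A0 h) (fun t V => Ch h (g t) + fh h t V)
        k (n%:R * k) (grid_values (grid h) (u (n%:R * k))) (Kbar h k n) in
    let rho := Ubar - grid_values (grid h) (u (n.+1%:R * k)) in
    rnorm rho <= M /\ rnorm (invmx (A0 h) *m rho) <= M * k.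
Proof.
have [mu u_bd] := C1_in_time_bounded T_gt0 u_C1.
have [mg g_bd] := C1_in_time_bounded T_gt0 g_C1.
have [lu u_lip] := C1_in_time_lipschitz T_gt0 u_C1.
have zeroI : 0 <= (0 : R) <= T by rewrite lexx ltW.
have mu0 : 0 <= mu := le_trans (rnorm_ge0 _) (u_bd _ zeroI).
have mg0 : 0 <= mg := le_trans (rnorm_ge0 _) (g_bd _ zeroI).
(* By the equation, [f t (u t)] is the derivative of [u] minus [A (u t)]. Uniqueness identifies this
   derivative with the continuous one from [u_C1], so both terms are bounded on [0, T]. *)
have [mf f_bd] : exists mf, forall t, 0 <= t <= T -> rnorm (f t (u t)) <= mf.
  have [u' du /(within_continuous_bounded T_gt0)[m1 u'_bd]] := u_C1.
  have [m2 Au_bd] := within_continuous_bounded T_gt0 Au_continuous.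
  exists (m1 + m2) => t tI.
  rewrite -[f t (u t)](addKr (A (u t))) addrC.
  rewrite (time_derivative_unique T_gt0 u_equation du)//.
  by rewrite (le_trans (rnormB _ _))// lerD ?u'_bd ?Au_bd.
have mf0 : 0 <= mf := le_trans (rnorm_ge0 _) (f_bd _ zeroI).
(* [G] bounds the boundary data after inversion of [A0 h], [F m] the source at states of norm at
   most [m], and [tm p m] a forced term with time gap [p * k], using [k <= k0]. Absolute values
   appear since the given constants carry no sign. *)
pose G := `|C''| * mg.
pose F m := `|L| * (m + mu) + mf.
pose tm p m := `|C'| * G / p + k0 * F m.
have G0 : 0 <= G by rewrite mulr_ge0.
have F0 m : 0 <= m -> 0 <= F m by move=> m0; rewrite addr_ge0// mulr_ge0// addr_ge0.
have tm0 p m : 0 < p -> 0 <= m -> 0 <= tm p m.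
  move=> p0 m0; rewrite addr_ge0//; first by rewrite divr_ge0 ?mulr_ge0// ltW.
  by rewrite mulr_ge0 ?F0// ltW.
have Gh h t : H h -> 0 <= t <= T -> rnorm (invmx (A0 h) *m Ch h (g t)) <= G.
  move=> Hh tI.
  have := @opnorm_le _ _ _ (fun v : Y => invmx (A0 h) *m Ch h v) `|C''|.
  move=> op; rewrite (le_trans (op _ _ (g t)))//.
  - by move=> r v; rewrite (linear_scale (Ch_linear _ Hh)) scalemxAr.
  - by rewrite (le_trans (A0_inv_Ch_bounded _ Hh))// lee_fin ler_norm.
  - by rewrite ler_wpM2l// g_bd.
have Fh h t V m : H h -> 0 <= t <= T -> nbh h t V -> rnorm V <= m ->
    rnorm (fh h t V) <= F m.
  move=> Hh tI nV Vm; have tI' : t \in `[0, T] by rewrite in_itv.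
  pose U := grid_values (grid h) (u t).
  rewrite -[fh h t V](subrK (fh h t U)) (le_trans (rnormD _ _))// lerD//; last first.
    by rewrite -fh_restriction// (le_trans (rnorm_grid_values _ _))// f_bd.
  rewrite (@le_trans _ _ (`|L| * rnorm (V - U)))//.
    apply: C1_with_segment (fh_C1 _ Hh) tI _ => theta thetaI.
    have := fhx_bounded _ _ _ Hh tI' (nbh_star _ _ _ _ Hh tI' nV thetaI).
    by move/le_trans; apply; rewrite lee_fin ler_norm.
  rewrite ler_wpM2l// (le_trans (rnormB _ _))// lerD//.
  by rewrite (le_trans (rnorm_grid_values _ _))// u_bd.
have timeI (k : R) n (r : R) : 0 < k -> n.+1%:R * k <= T -> 0 <= r <= 1 ->
    0 <= n%:R * k + r * k <= T.
  move=> /ltW k_ge0 nkT /andP[r0 r1]; apply/andP; split.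
    by rewrite -mulrDl mulr_ge0 ?addr_ge0.
  by rewrite -mulrDl (le_trans _ nkT)// ler_wpM2r// -natr1 lerD2l.
have U_bd h k n : 0 < k -> n.+1%:R * k <= T ->
    rnorm (grid_values (grid h) (u (n%:R * k))) <= mu.
  move=> k_gt0 nkT; rewrite (le_trans (rnorm_grid_values _ _))// u_bd//.
  by have := timeI k n 0 k_gt0 nkT; rewrite mul0r addr0; apply; rewrite lexx ler01.
have term_bd h k n p i m : H h -> h <= h0 -> 0 < k -> k <= k0 ->
    n.+1%:R * k <= T -> 0 < p -> 0 <= m -> rnorm (Kbar h k n i) <= m ->
    rnorm (k%:C *: (expmx ((p * k)%:C *: A0 h) *m (Ch h (g (n%:R * k + c i * k))
      + fh h (n%:R * k + c i * k) (Kbar h k n i)))) <= tm p m.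
  move=> Hh hh0 k_gt0 kk0 nkT p0 m0 Km.
  have tI := timeI _ _ _ k_gt0 nkT (c_range i).
  have pk0 : 0 <= p * k by rewrite mulr_ge0// ltW.
  apply: le_trans (rnorm_forced_term (A0_unit _ Hh) _ (normr_ge0 C') p0 (ltW k_gt0)
    _ (Gh _ _ Hh tI) (Fh _ _ _ _ Hh tI (Kbar_stays _ _ _ _ Hh hh0 k_gt0 kk0 nkT) Km)) _.
  - by move=> t; exact: A0_contractive.
  - by rewrite (le_trans (A0_parabolic _ _ Hh hh0 pk0))// lee_fin ler_norm.
  - by rewrite lerD2l ler_wpM2r// F0.
(* Induction on the number of stages; [m] is chosen before [h], [k] and [n], which makes it uniform
   in them. *)
have stages q : exists2 m, 0 <= m & forall i : 'I_s, (i < q)%N -> forall h k n,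
    H h -> h <= h0 -> 0 < k -> k <= k0 -> n.+1%:R * k <= T ->
    rnorm (Kbar h k n i) <= m.
  elim: q => [|q [m m0 IH]]; first by exists 0.
  have sum0 (i : 'I_s) :
      0 <= \sum_(j < s | (j < i)%N) `|a i j| * tm (c i - c j) m.
    by apply: sumr_ge0 => j ji; rewrite mulr_ge0 ?tm0// subr_gt0 c_increasing.
  (* Summing over every row gives one constant for all stages; the other rows are nonnegative
     because [c] is increasing. *)
  pose Sa := \sum_(i < s) \sum_(j < s | (j < i)%N) `|a i j| * tm (c i - c j) m.
  have Sa0 : 0 <= Sa by apply: sumr_ge0 => i _; exact: sum0.
  exists (mu + Sa) => [|i iq h k n Hh hh0 k_gt0 kk0 nkT]; first exact: addr_ge0.
  rewrite Kbar_def// (le_trans (rnormD _ _))// lerD//.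
    rewrite (le_trans _ (U_bd h _ _ k_gt0 nkT))// rnorm_expmx_le//.
      by move=> t; exact: A0_contractive.
    by rewrite mulr_ge0 ?(ltW k_gt0)//; case/andP: (c_range i).
  rewrite /Sa [leRHS](bigD1 i)//= ler_wpDr ?sumr_ge0// scaler_sumr.
  rewrite (le_trans (rnorm_sum _ _ _))//; apply: ler_sum => j ji.
  rewrite scalerA mulrC -scalerA rnormZr ler_wpM2l// term_bd//.
    by rewrite subr_gt0 c_increasing.
  by apply: IH => //; exact: leq_trans ji _.
have [m m0 Kbar_bd] := stages s.
pose S1 := \sum_(i < s) `|b i| * tm (1 - c i) m.
pose S2 := \sum_(i < s) `|b i| * (G + `|C| * F m).
have lu0 : 0 <= lu.
  have := u_lip 0 T (lexx 0) (ltW T_gt0) (lexx T); rewrite subr0.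
  by move/(le_trans (rnorm_ge0 _)); rewrite pmulr_lge0.
(* The sum of two absolute values dominates the bound of each claim. *)
exists (`|mu + S1 + mu| + `|mu + S2 + `|C| * lu|) => h k n Hh hh0 k_gt0 kk0 nkT Ubar rho.
have k_ge0 := ltW k_gt0.
have contr t : 0 <= t -> (mxopnorm (expmx (t%:C *: A0 h)) <= 1)%E.
  exact: A0_contractive.
have c_lt1 i : 0 < 1 - c i.
  by rewrite subr_gt0 lt_neqAle c_neq1; case/andP: (c_range i).
have n1k : n.+1%:R * k = n%:R * k + k by rewrite -natr1 mulrDl mul1r.
have KE i : rnorm (Kbar h k n i) <= m by exact: Kbar_bd.
split.
- rewrite (@le_trans _ _ (mu + S1 + mu))//; last first.
    by rewrite (le_trans (ler_norm _))// lerDl.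
  rewrite (le_trans (rnormB _ _))// lerD//; last first.
    rewrite (le_trans (rnorm_grid_values _ _))// u_bd// nkT andbT.
    by rewrite mulr_ge0.
  rewrite (le_trans (rnormD _ _))// lerD//.
    by rewrite (le_trans _ (U_bd h _ _ k_gt0 nkT))// rnorm_expmx_le.
  rewrite scaler_sumr (le_trans (rnorm_sum _ _ _))//; apply: ler_sum => i _.
  by rewrite scalerA mulrC -scalerA rnormZr ler_wpM2l// term_bd.
rewrite (@le_trans _ _ ((mu + S2 + `|C| * lu) * k))//; last first.
  by rewrite ler_wpM2r// (le_trans (ler_norm _))// lerDr.
pose U0 := grid_values (grid h) (u (n%:R * k)).
set X := k%:C *: \sum_(i < s) (b i)%:C *: (expmx (((1 - c i) * k)%:C *: A0 h) *m
  (Ch h (g (n%:R * k + c i * k)) + fh h (n%:R * k + c i * k) (Kbar h k n i))).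
(* Inserting [U0] splits the error into the homogeneous increment, the forced sum and the increment
   of the exact solution; after inversion of [A0 h] each is of order [k]. *)
have -> : rho = (expmx (k%:C *: A0 h) *m U0 - U0) + X -
    grid_values (grid h) (u (n.+1%:R * k) - u (n%:R * k)).
  rewrite grid_valuesB opprB /rho /Ubar /lawson_step -/U0 -/X -!addrA.
  by congr (_ + _); rewrite (addrCA X) addKr.
have A0C : (mxopnorm (invmx (A0 h)) <= `|C|%:E)%E.
  by rewrite (le_trans (A0_inv_bounded _ Hh))// lee_fin ler_norm.
rewrite mulmxBr mulmxDr (le_trans (rnormB _ _))// mulrDl lerD//; last first.
  rewrite (le_trans (mxopnorm_le _ A0C))// -mulrA ler_wpM2l//.
  rewrite (le_trans (rnorm_grid_values _ _))//.
  rewrite (le_trans (u_lip (n%:R * k) (n.+1%:R * k) _ _ nkT))//.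
  - by rewrite mulr_ge0.
  - by rewrite n1k lerDl.
  - by rewrite n1k addrAC subrr add0r.
rewrite (le_trans (rnormD _ _))// mulrDl lerD//.
  rewrite (le_trans (rnorm_invmx_expmx_sub1 _ (A0_unit _ Hh) contr k_ge0))//.
  by rewrite mulrC ler_wpM2r// U_bd.
(* Here the outer factor [k] is kept, and each summand is bounded independently of it. *)
rewrite /X -scalemxAr rnormZr ger0_norm// mulrC ler_wpM2r// mulmx_sumr.
rewrite (le_trans (rnorm_sum _ _ _))//; apply: ler_sum => i _.
rewrite -scalemxAr rnormZr ler_wpM2l//.
have tI := timeI _ _ _ k_gt0 nkT (c_range i).
apply: rnorm_invmx_forced_term => //.
- exact: A0_unit.
- by rewrite mulr_ge0// ltW.
- exact: Gh.
- by apply: Fh => //; exact: Kbar_stays.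
Qed.
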